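(* The map $\Phi$ is a bijection between $\mathcal{K}_0^n$ and $\mathcal{F}^n$. Moreover, the polarity map $\circ:\mathcal{K}_0^n\to\mathcal{K}_0^n$ decomposes as $$\circ:\ \mathcal{K}_0^n\stackrel{\clubsuit}{\longrightarrow}\mathcal{F}^n\stackrel{\Phi}{\longrightarrow}\mathcal{K}_0^n,$$ in the sense that $\Phi\left(K^{\clubsuit}\right)=K^{\circ}$ for all $K\in\mathcal{K}_0^n$.
   Context: A convex body in $\mathbb{R}^n$ is a closed convex set $K\subseteq\mathbb{R}^n$ with $0\in K$ (not assumed compact, nor with non-empty interior); $\mathcal{K}_0^n$ is the set of all convex bodies. The support function of $K$ is $h_K:S^{n-1}\to[0,\infty]$, $h_K(\theta)=\sup_{x\in K}\langle x,\theta\rangle$, and $K^\circ=\{y\in\mathbb{R}^n:\langle x,y\rangle\le 1\text{ for all }x\in K\}$. A star set is a non-empty $A\subseteq\mathbb{R}^n$ such that $x\in A$ and $0\le\lambda\le1$ imply $\lambda x\in A$; its radial function is $r_A:S^{n-1}\to[0,\infty]$, $r_A(\theta)=\sup\{\lambda\ge0:\lambda\theta\in A\}$. A star body is a star set $A$ with $r_A(\theta)\theta\in A$ for all $\theta\in S^{n-1}$ with $r_A(\theta)<\infty$; it is uniquely determined by $r_A$. For $K\in\mathcal{K}_0^n$, $K^{\clubsuit}$ is the star body with radial function $r_{K^{\clubsuit}}=h_K$. For a star body $A$, $\Phi(A)$ is the star body with radial function $r_{\Phi(A)}=1/r_A$ ($1/0=\infty$, $1/\infty=0$). $B(y,r)$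 is the closed Euclidean ball with center $y$ and radius $r\ge0$. A star body $A$ is a flower if $A=\bigcup_{x\in C}B\left(\frac{x}{2},\frac{|x|}{2}\right)$ for some closed set $C\subseteq\mathbb{R}^n$; $\mathcal{F}^n$ is the class of all flowers in $\mathbb{R}^n$.
   Formalization: A flower is a star body equal to the union of the balls B(x/2,|x|/2), x in closed C, together with the missing endpoints of its rays of finite length; with literal equality the claim fails for n ≥ 2, as the supremum along a ray may be finite but not attained. *)

(* Defs.v *)
From HB Require Import structures.
From mathcomp Require Import all_boot all_order all_algebra.
From mathcomp Require Import all_classical all_reals ereal topology normedtype convex.

Set Implicit Arguments.
Unset Strict Implicit.
Unset Printing Implicit Defensive.
Import Order.TTheory GRing.Theory Num.Theory numFieldNormedType.Exports.
Local Open Scope classical_set_scope.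
Local Open Scope ring_scope.

(* R^n is 'rV[R]_n.  The library norm on 'rV[R]_n is the sup norm (it induces
   the usual topology, so [closed] is the usual notion); the Euclidean structure
   is therefore introduced here. *)
Section Euclidean.
Context {R : realType} {n : nat}.
Implicit Types x y : 'rV[R]_n.

Definition dot x y : R := \sum_(i < n) x ord0 i * y ord0 i.

Definition enorm x : R := Num.sqrt (dot x x).

Definition sphere : set 'rV[R]_n := [set x | enorm x = 1].

Definition eball y (r : R) : set 'rV[R]_n := [set x | enorm (x - y) <= r].

End Euclidean.

Section Bodies.
Context {R : realType} {n : nat}.
Implicit Types A K : set 'rV[R]_n.
Implicit Types rho : 'rV[R]_n -> \bar R.

Definition convex_body K := [/\ closed K, convex_set K & K 0].

(* Support and radial functions are functions on the sphere: their values at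
   vectors that are not of norm 1 are irrelevant. *)
Definition support K (theta : 'rV[R]_n) : \bar R :=
  ereal_sup [set (dot x theta)%:E | x in K].

Definition polar K : set 'rV[R]_n := [set y | forall x, K x -> dot x y <= 1].

Definition star_set A :=
  A !=set0 /\ forall x (l : R), A x -> 0 <= l <= 1 -> A (l *: x).

Definition radial A (theta : 'rV[R]_n) : \bar R :=
  ereal_sup [set l%:E | l in [set l : R | 0 <= l /\ A (l *: theta)]].

Definition star_body A :=
  star_set A /\
  forall theta, sphere theta ->
    (radial A theta < +oo)%E -> A (fine (radial A theta) *: theta).

(* The star body with radial function rho, for rho >= 0 on the sphere; existence
   and uniqueness are the lemmas star_body_of_star_body, radial_star_body_of and
   star_body_inj below. *)
Definition star_body_of rho : set 'rV[R]_n :=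
  [set x | x = 0 \/ ((enorm x)%:E <= rho ((enorm x)^-1 *: x))%E].

Definition clubsuit K := star_body_of (support K).

(* On \bar R the library inverse satisfies 0^-1 = +oo and +oo^-1 = 0. *)
Definition Phi A := star_body_of (fun theta => ((radial A theta)^-1)%E).

(* A together with the endpoint of each of its rays of finite length. *)
Definition ray_closure A :=
  A `|` [set fine (radial A theta) *: theta |
           theta in sphere `&` [set theta | radial A theta \is a fin_num]].

(* For an unbounded C the supremum of the radial functions of the balls may be
   finite but not attained; the union is then not a star body, and is
   represented by the star body having the same radial function.  Whenever the
   union is itself a star body, taking the ray closure does not change it (see
   ray_closure_id).  Without the ray closure, the flower of
   {(a, b) | forall t in [0, 1], b <= (1 - t)^2 + t^2 a} would not qualify. *)
Definition flower A :=
  star_body A /\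
  exists2 C : set 'rV[R]_n, closed C &
    A = ray_closure (\bigcup_(x in C) eball (2^-1 *: x) (enorm x / 2)).

End Bodies.

Section BasicFacts.
Context {R : realType} {n : nat}.
Implicit Types x : 'rV[R]_n.
Implicit Types A B : set 'rV[R]_n.
Implicit Types rho : 'rV[R]_n -> \bar R.

Let le0_cases (l : R) : 0 <= l -> 0 = l \/ 0 < l.
Proof. by rewrite le_eqVlt => /predU1P. Qed.

Lemma dot_ge0 x : 0 <= dot x x.
Proof. by apply: sumr_ge0 => i _; rewrite -expr2 sqr_ge0. Qed.

Lemma enorm_eq0 x : enorm x = 0 -> x = 0.
Proof.
move=> /eqP; rewrite sqrtr_eq0 => x0.
have /eqP : dot x x = 0 by apply/eqP; rewrite eq_le x0 dot_ge0.
rewrite psumr_eq0 => [/allP h|i _]; last by rewrite -expr2 sqr_ge0.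
apply/rowP => i; rewrite mxE; have := h i (mem_index_enum i).
by rewrite mulf_eq0 orbb => /eqP.
Qed.

Lemma enormZ (a : R) x : enorm (a *: x) = `|a| * enorm x.
Proof.
rewrite /enorm -sqrtr_sqr -sqrtrM ?sqr_ge0//; congr Num.sqrt.
by rewrite /dot mulr_sumr; apply: eq_bigr => i _; rewrite !mxE mulrACA expr2.
Qed.

Lemma enorm0 : enorm (0 : 'rV[R]_n) = 0.
Proof. by rewrite -(scale0r 0) enormZ normr0 mul0r. Qed.

Lemma enorm_ge0 x : 0 <= enorm x. Proof. exact: sqrtr_ge0. Qed.

Lemma sphere_normalize x : x != 0 -> sphere ((enorm x)^-1 *: x).
Proof.
move=> x0; rewrite /sphere /= enormZ ger0_norm ?invr_ge0 ?enorm_ge0// mulVf//.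
by apply: contra x0 => /eqP /enorm_eq0 ->.
Qed.

Lemma star_body_ofZ rho theta (l : R) : sphere theta -> 0 < l ->
  star_body_of rho (l *: theta) <-> (l%:E <= rho theta)%E.
Proof.
move=> th l0; rewrite /star_body_of /= enormZ th mulr1 gtr0_norm// scalerA.
rewrite mulVf ?gt_eqF// scale1r; split=> [[/(congr1 enorm)|//]|]; last by right.
by rewrite enormZ th mulr1 enorm0 => /normr0P /eqP l0'; rewrite l0' ltxx in l0.
Qed.

Lemma radial_star_body_of rho theta : sphere theta -> (0 <= rho theta)%E ->
  radial (star_body_of rho) theta = rho theta.
Proof.
move=> th rho0; apply/eqP; rewrite eq_le; apply/andP; split.
  apply: ge_ereal_sup => _ [l [l0 Al] <-].
  move: l0 => /le0_cases [<-//|l0].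
  exact/(star_body_ofZ _ th l0).
have ub (l : R) : 0 <= l -> (l%:E <= rho theta)%E ->
    (l%:E <= radial (star_body_of rho) theta)%E.
  move=> l0 lr; apply: ereal_sup_ubound; exists l => //; split=> //.
  move: l0 => /le0_cases [<-|l0]; first by left; rewrite scale0r.
  exact/star_body_ofZ.
case E : (rho theta) => [r| |]; last by rewrite leNye.
  by apply: ub; rewrite ?E// -lee_fin -E.
rewrite leye_eq; apply/eqP/eqyP => l l0.
by apply: ub; rewrite ?(ltW l0)// E leey.
Qed.

Lemma star_body_of_star_body rho :
  (forall theta, sphere theta -> (0 <= rho theta)%E) ->
  star_body (star_body_of rho).
Proof.
move=> rho0; split; first split; first by exists 0; left.
  move=> x l [->|xr] /andP[l0 l1]; first by left; rewrite scaler0.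
  move: l0 => /le0_cases [<-|l0]; first by left; rewrite scale0r.
  have [->|x0] := eqVneq x 0; first by left; rewrite scaler0.
  have nx0 : enorm x != 0 by apply: contra x0 => /eqP /enorm_eq0 ->.
  right; rewrite enormZ gtr0_norm// scalerA invfM mulrAC mulVf ?gt_eqF// mul1r.
  by apply: le_trans xr; rewrite lee_fin ler_piMl// enorm_ge0.
move=> theta th; have r0 := rho0 _ th; rewrite radial_star_body_of//.
case E : (rho theta) r0 => [r| |]//; rewrite lee_fin => r0 _ /=.
move: r0 => /le0_cases [<-|r0]; first by left; rewrite scale0r.
by apply/star_body_ofZ => //; rewrite E.
Qed.

Lemma star_body0 A : star_body A -> A 0.
Proof.
case=> [[[x Ax] h]] _; rewrite -(scale0r x).
by apply: h => //; rewrite lexx ler01.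
Qed.

Lemma star_body_of_radial A : star_body A -> star_body_of (radial A) = A.
Proof.
move=> Ab; have [[_ sA] eA] := Ab; apply/seteqP; split=> x.
  have [-> _|x0 [x0'|]] := eqVneq x 0; first exact: star_body0.
    by rewrite x0' eqxx in x0.
  have nx0 : 0 < enorm x.
    rewrite lt_neqAle enorm_ge0 andbT eq_sym.
    by apply: contra x0 => /eqP /enorm_eq0 ->.
  have th := sphere_normalize x0; set theta := _ *: x in th *.
  have -> : A x = A (enorm x *: theta).
    by rewrite /theta scalerA divff ?gt_eqF// scale1r.
  case E : (radial A theta) => [r| |]//=; rewrite ?lee_fin => xr.
    have Ar : A (r *: theta) by have := eA _ th; rewrite E ltry; apply.
    have r0 : 0 < r := lt_le_trans nx0 xr.
    rewrite -(mulfVK (lt0r_neq0 r0) (enorm x)) -scalerA; apply: sA => //.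
    by rewrite divr_ge0 ?(ltW r0) ?(ltW nx0)//= ler_pdivrMr// mul1r.
  have : ((enorm x)%:E < radial A theta)%E by rewrite E ltry.
  move=> /ereal_sup_gt [_ [l [l0 Al] <-]]; rewrite lte_fin => xl.
  have l0' : 0 < l := lt_trans nx0 xl.
  rewrite -(mulfVK (lt0r_neq0 l0') (enorm x)) -scalerA; apply: sA => //.
  by rewrite divr_ge0 ?(ltW nx0)//= ler_pdivrMr// mul1r ltW.
move=> Ax; have [->|x0] := eqVneq x 0; first by left.
right; apply: ereal_sup_ubound; exists (enorm x) => //; split.
  exact: enorm_ge0.
by rewrite scalerA divff ?scale1r//; apply: contra x0 => /eqP /enorm_eq0 ->.
Qed.

Lemma star_body_inj A B : star_body A -> star_body B ->
  (forall theta, sphere theta -> radial A theta = radial B theta) -> A = B.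
Proof.
move=> Ab Bb h; rewrite -(star_body_of_radial Ab) -(star_body_of_radial Bb).
rewrite predeqE => x; have [->|x0] := eqVneq x 0; first by split; left.
by rewrite /star_body_of /= h//; exact: sphere_normalize.
Qed.

Lemma ray_closure_id A : star_body A -> ray_closure A = A.
Proof.
case=> _ eA; apply/seteqP; split=> x; last by left.
by case=> // -[theta [th fA] <-]; apply: eA => //; rewrite ltey_eq fA.
Qed.

End BasicFacts.

(* Main.v *)
Require Import Defs.
From HB Require Import structures.
From mathcomp Require Import all_boot all_order all_algebra.
From mathcomp Require Import all_classical all_reals ereal topology normedtype convex.
From mathcomp Require Import derive ring lra.

(** By Thales, the ball with diameter [[0, c]] meets the ray spanned by a unit
    vector [theta] exactly up to the projection [dot c theta].  A union of such
    balls over a nonempty set [C] therefore has radial function the positive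
    part of the support function of [C] ([radial_ball_union]).  This has two
    consequences.
    - If [K] contains [0], its support function is nonnegative, so that
      [clubsuit K] is the flower spanned by [K] itself ([clubsuitE]).
    - For every nonempty [C], [Phi] sends the flower spanned by [C] to the polar
      of [C] ([Phi_ball_union]), because [|y| <= 1 / h (y / |y|)] says that
      [dot c y <= 1] for every [c] in [C].
    Hence [Phi] sends flowers to convex bodies, as polars are convex bodies, and
    [Phi (clubsuit K) = polar K].

    On star bodies [Phi] is an involution ([PhiK]), since inversion is one on
    [[0, +oo]].  The bipolar theorem ([polarK]) writes a convex body [K] as
    [polar (polar K)], i.e. as [Phi] of the flower [clubsuit (polar K)]; applying
    [Phi] gives [Phi K = clubsuit (polar K)] ([Phi_convex_body]).  So [Phi] maps
    convex bodies to flowers.  The equality [K = Phi (clubsuit (polar K))] also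
    shows that convex bodies are star bodies, on which [Phi] is its own inverse;
    therefore it exchanges the two classes bijectively.

    The bipolar theorem is proved by separating a point [y] outside [K] from [K]
    with a hyperplane orthogonal to [y - p], where [p] is the Euclidean
    projection of [y] on [K]. *)

Set Implicit Arguments.
Unset Strict Implicit.
Unset Printing Implicit Defensive.
Import Order.TTheory GRing.Theory Num.Theory numFieldNormedType.Exports.
Local Open Scope classical_set_scope.
Local Open Scope ring_scope.

(** * The Euclidean inner product *)

Section InnerProduct.
Context {R : realType} {n : nat}.
Implicit Types x y z : 'rV[R]_n.

Lemma dotC x y : dot x y = dot y x.
Proof. by apply: eq_bigr => i _; rewrite mulrC. Qed.

Lemma dotDl x y z : dot (x + y) z = dot x z + dot y z.
Proof. by rewrite /dot -big_split; apply: eq_bigr => i _; rewrite mxE mulrDl. Qed.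

Lemma dotZl (a : R) x y : dot (a *: x) y = a * dot x y.
Proof. by rewrite /dot mulr_sumr; apply: eq_bigr => i _; rewrite mxE mulrA. Qed.

Lemma dotNl x y : dot (- x) y = - dot x y.
Proof. by rewrite -scaleN1r dotZl mulN1r. Qed.

Lemma dotDr x y z : dot z (x + y) = dot z x + dot z y.
Proof. by rewrite dotC dotDl !(dotC z). Qed.

Lemma dotZr (a : R) x y : dot y (a *: x) = a * dot y x.
Proof. by rewrite dotC dotZl (dotC y). Qed.

Lemma dotNr x y : dot y (- x) = - dot y x.
Proof. by rewrite dotC dotNl (dotC y). Qed.

Lemma dot0l x : dot 0 x = 0.
Proof. by rewrite -(scale0r 0) dotZl mul0r. Qed.

Definition dotE := (dotDl, dotDr, dotZl, dotZr, dotNl, dotNr).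

Lemma sqr_enorm x : enorm x ^+ 2 = dot x x.
Proof. by rewrite sqr_sqrtr // dot_ge0. Qed.

Lemma dot_gt0 x : x != 0 -> 0 < dot x x.
Proof.
move=> x0; rewrite -sqr_enorm exprn_gt0// lt_neqAle enorm_ge0 andbT eq_sym.
by apply: contra x0 => /eqP /enorm_eq0 ->.
Qed.

Lemma enorm_gt0 x : x != 0 -> 0 < enorm x.
Proof. by move=> /dot_gt0 x0; rewrite /enorm sqrtr_gt0. Qed.

Lemma dot_sphere x : sphere x -> dot x x = 1.
Proof. by rewrite -sqr_enorm => ->; rewrite expr1n. Qed.

Lemma enormK x : enorm x *: ((enorm x)^-1 *: x) = x.
Proof.
have [->|/enorm_gt0 x0] := eqVneq x 0; first by rewrite !scaler0.
by rewrite scalerA divff ?gt_eqF// scale1r.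
Qed.

(** Thales: [y] lies in the ball with diameter [0, x] iff the angle at [y] of
    the triangle [0, y, x] is at least a right angle. *)
Lemma eball_diameterP x y :
  eball (2^-1 *: x) (enorm x / 2) y <-> dot y y <= dot x y.
Proof.
rewrite /eball /= -(@ler_pXn2r _ 2%N)// ?nnegrE ?enorm_ge0//; last first.
  by rewrite divr_ge0// enorm_ge0.
rewrite exprMn !sqr_enorm !dotE (dotC y x).
by split; lra.
Qed.

Lemma cvg_dot (T : Type) (F : set_system T) (f g : T -> 'rV[R]_n) x y :
  Filter F -> f @ F --> x -> g @ F --> y ->
  dot (f t) (g t) @[t --> F] --> dot x y.
Proof.
move=> FF fx gy; apply: cvg_big => [|i _]; first exact: add_continuous.
apply: cvgM.
  exact: (cvg_comp _ _ fx (@coord_continuous _ _ _ ord0 i x)).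
exact: (cvg_comp _ _ gy (@coord_continuous _ _ _ ord0 i y)).
Qed.

(** The norm here is the sup norm: this crude comparison with the Euclidean one
    is enough to transfer boundedness, and follows from [t <= 1 + t ^+ 2] on each
    coordinate. *)
Lemma le_normr_dot x : `|x| <= 1 + dot x x.
Proof.
have dx0 := dot_ge0 x.
rewrite /Num.Def.normr /= mx_normrE (bigmax_le _ (addr_ge0 ler01 dx0))//=.
move=> [i j] _ /=.
have x2 : `|x i j| ^+ 2 <= dot x x.
  rewrite real_normK ?num_real// expr2 (ord1 i) /dot (bigD1 j)//= lerDl.
  by apply: sumr_ge0 => k _; rewrite -expr2 sqr_ge0.
by apply: le_trans (lerD (lexx 1) x2); nra.
Qed.

End InnerProduct.

(** * Separation and the bipolar theorem *)

Section Bipolar.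
Context {R : realType} {n : nat}.
Implicit Types x y z : 'rV[R]_n.
Implicit Types C K : set 'rV[R]_n.

Lemma convex_setP K : convex_set K <->
  forall x y (t : R), K x -> K y -> 0 <= t <= 1 -> K (t *: x + (1 - t) *: y).
Proof.
split=> [cK x y t Kx Ky t01|cK x y t]; last first.
  rewrite !inE => Kx Ky; apply: (cK x y t%:num) => //.
  by rewrite ge0 le1.
have := cK x y (Itv01 (proj1 (andP t01)) (proj2 (andP t01))).
by rewrite !inE; apply.
Qed.

(** A polar is an intersection of closed half-spaces containing [0]. *)
Lemma polar_convex_body C : convex_body (polar C).
Proof.
split; first 1 last.
- apply/convex_setP => y z t Cy Cz /andP[t0 t1] x Cx.
  have := Cy x Cx; have := Cz x Cx; rewrite !dotE; nra.
- by move=> x _; rewrite dotC dot0l ler01.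
have -> : polar C = \bigcap_(x in C) [set y | dot x y <= 1] by [].
apply: closed_bigI => x _.
apply: (@preimage_closed _ _ (dot x) [set r | r <= 1]); last exact: closed_le.
move=> y _; apply: (@cvg_dot _ _ _ (nbhs y) (cst x) id); first exact: cvg_cst.
exact: cvg_id.
Qed.

(** Only the points of [K] at least as close to [y] as a fixed point of [K]
    matter, and they form a compact set. *)
Lemma nearest_point K y : closed K -> K !=set0 ->
  exists2 p, K p & forall x, K x -> dot (p - y) (p - y) <= dot (x - y) (x - y).
Proof.
move=> cK [x0 Kx0]; pose f x := dot (x - y) (x - y).
have cf : continuous f.
  have cB x : (z - y) @[z --> x] --> x - y.
    exact: (cvgB cvg_id (cvg_cst y)).
  by move=> x; exact: (cvg_dot _ (cB x) (cB x)).
pose A := K `&` f @^-1` [set r | r <= f x0].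
have cA : closed A.
  apply: closedI => //; apply: preimage_closed (@closed_le _ _) => x _.
  exact: cf.
have bA : bounded_set A.
  exists (1 + f x0 + `|y|); split; first exact: num_real.
  move=> M AM x [_ /= fx]; apply: le_trans (ltW AM).
  rewrite -[x](subrK y) (le_trans (ler_normD _ _))// lerD2r.
  by rewrite (le_trans (le_normr_dot _))// lerD2l.
have A0 : A !=set0 by exists x0; split=> //=.
have [p] := compact_EVT_min A0 (bounded_closed_compact bA cA)
  (continuous_subspaceT cf).
rewrite inE => -[Kp fp] pmin; exists p => // x Kx.
have [fx|/ltW fx] := leP (f x) (f x0); last exact: le_trans fp fx.
by apply: pmin; rewrite inE.
Qed.

(** Moving from [p] towards [x] inside the convex set cannot decrease the
    distance to [y], so the derivative of the squared distance is nonnegative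
    at [p]. *)
Lemma nearest_point_obtuse K y p x : convex_set K -> K p -> K x ->
  (forall x, K x -> dot (p - y) (p - y) <= dot (x - y) (x - y)) ->
  dot (x - p) (y - p) <= 0.
Proof.
move=> /convex_setP cK Kp Kx pmin.
set a := dot (x - p) (y - p); set b := dot (x - p) (x - p).
have b0 : 0 <= b := dot_ge0 _.
have quad t : 0 <= t <= 1 -> 2 * t * a <= t ^+ 2 * b.
  move=> t01; have := pmin _ (cK x p t Kx Kp t01).
  have -> : t *: x + (1 - t) *: p - y = t *: (x - p) - (y - p).
    by apply/rowP => i; rewrite !mxE; ring.
  have -> : p - y = - (y - p) by rewrite opprB.
  rewrite !(dotDl (t *: _)) !(dotDr (t *: _)) !(dotZl t) !(dotZr t).
  rewrite !(dotNl (y - p)) !(dotNr (y - p)) (dotC (y - p) (x - p)) -/a -/b.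
  lra.
rewrite leNgt; apply/negP => a0.
have ab0 : 0 < a + b by rewrite ltr_wpDr.
(* The inequality [2 * t * a <= t ^+ 2 * b] fails as soon as [0 < t] and
   [t * b < 2 * a]; [t = a / (a + b)] has both properties and is at most 1. *)
have : 0 <= a / (a + b) <= 1.
  by rewrite divr_ge0 ?(ltW a0) ?(ltW ab0)//= ler_pdivrMr// mul1r lerDl.
move=> /quad; set t := _ / _ => tab.
have t0 : 0 < t by rewrite divr_gt0.
have tE : t * (a + b) = a by rewrite mulfVK// gt_eqF.
nra.
Qed.

(** If [y] is not in [K], the hyperplane orthogonal to [y - p] through the point
    midway between [y] and its nearest point [p] strictly separates [y] from
    [K]; since [0] lies in [K] it can be normalized to a level set at height
    one, i.e. to an element of [polar K] that excludes [y] from the bipolar. *)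
Lemma polarK K : convex_body K -> polar (polar K) = K.
Proof.
case=> cK vK K0; apply/seteqP; split=> [y Ky|y Ky x]; last first.
  by move=> Kx; rewrite dotC; exact: Kx.
apply: contrapT => nKy.
have [p Kp pmin] := nearest_point y cK (ex_intro _ 0 K0).
have obt x (Kx : K x) := nearest_point_obtuse vK Kp Kx pmin.
have u0 : 0 < dot (y - p) (y - p).
  by apply: dot_gt0; rewrite subr_eq0; apply/eqP => yp; rewrite yp in nKy.
have pu : 0 <= dot p (y - p).
  by have := obt 0 K0; rewrite sub0r dotNl oppr_le0.
have yE : dot y (y - p) = dot p (y - p) + dot (y - p) (y - p).
  by rewrite -dotDl [p + _]addrC subrK.
set u := y - p in obt u0 pu yE.
pose c := dot p u + dot u u / 2.
have c0 : 0 < c by rewrite /c; lra.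
have : dot (c^-1 *: u) y <= 1.
  apply: Ky => x Kx; rewrite dotZr ler_pdivrMl// mulr1.
  by have := obt x Kx; rewrite dotDl dotNl /c; lra.
by rewrite dotZl ler_pdivrMl// mulr1 dotC yE /c; lra.
Qed.

End Bipolar.

(** * Star sets and the involution Phi *)

Section StarSets.
Context {R : realType} {n : nat}.
Implicit Types x theta : 'rV[R]_n.
Implicit Types A : set 'rV[R]_n.

Lemma star_set0 A : star_set A -> A 0.
Proof.
by case=> [[x Ax] h]; rewrite -(scale0r x); apply: h; rewrite // lexx ler01.
Qed.

Lemma radial_ge0 A theta : A 0 -> (0 <= radial A theta)%E.
Proof. by move=> A0; apply: ereal_sup_ubound; exists 0; rewrite //= scale0r. Qed.

Lemma radial_ubound A x : A x -> ((enorm x)%:E <= radial A ((enorm x)^-1 *: x))%E.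
Proof.
move=> Ax; apply: ereal_sup_ubound; exists (enorm x) => //.
by rewrite /= enorm_ge0 enormK.
Qed.

(** A ray of a star set is a segment whose only possibly missing point is its
    endpoint, which is what the ray closure adds. *)
Lemma ray_closureE A : star_set A -> ray_closure A = star_body_of (radial A).
Proof.
move=> sA; have A0 := star_set0 sA; have [_ hA] := sA.
apply/seteqP; split=> x.
  case=> [Ax|[theta [th fr] <-]]; first by right; exact: radial_ubound.
  have := radial_ge0 theta A0; rewrite -(fineK fr) lee_fin le_eqVlt.
  case/predU1P => [<-|r0]; first by left; rewrite scale0r.
  by apply/star_body_ofZ => //; rewrite fineK.
have [-> _|x0 [xE|]] := eqVneq x 0; first by left.
  by rewrite xE eqxx in x0.
have nx0 := enorm_gt0 x0; have th := sphere_normalize x0.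
rewrite le_eqVlt => /predU1P[xr|/ereal_sup_gt[_ [l [l0 Al] <-]]].
  right; exists ((enorm x)^-1 *: x); last by rewrite -xr enormK.
  by split=> //=; rewrite -xr.
rewrite lte_fin => xl; have lgt0 := lt_trans nx0 xl.
left; have -> : x = (enorm x / l) *: (l *: ((enorm x)^-1 *: x)).
  by rewrite scalerA mulfVK ?gt_eqF// enormK.
by apply: hA => //; rewrite divr_ge0 ?(ltW nx0)//= ler_pdivrMr// mul1r ltW.
Qed.

Lemma eq_star_body_of (rho1 rho2 : 'rV[R]_n -> \bar R) :
  (forall theta, sphere theta -> rho1 theta = rho2 theta) ->
  star_body_of rho1 = star_body_of rho2.
Proof.
move=> h; rewrite predeqE => x; have [->|x0] := eqVneq x 0.
  by split; left.
by rewrite /star_body_of /= h//; exact: sphere_normalize.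
Qed.

(** [Phi] only sees the radial function, which the missing endpoints do not
    affect. *)
Lemma Phi_ray_closure A : star_set A -> Phi (ray_closure A) = Phi A.
Proof.
move=> sA; rewrite ray_closureE//; apply: eq_star_body_of => theta th.
by rewrite radial_star_body_of// radial_ge0//; exact: star_set0.
Qed.

Lemma PhiK A : star_body A -> Phi (Phi A) = A.
Proof.
move=> bA; have A0 := star_body0 bA.
rewrite -[RHS](star_body_of_radial bA); apply: eq_star_body_of => theta th.
by rewrite radial_star_body_of// ?inveK// inve_ge0 radial_ge0.
Qed.

Lemma PhiP A x : A 0 -> x != 0 ->
  Phi A x <-> (radial A ((enorm x)^-1 *: x) <= ((enorm x)^-1)%:E)%E.
Proof.
move=> A0 x0; have nx0 := enorm_gt0 x0.
have -> : ((enorm x)^-1)%:E = ((enorm x)%:E^-1)%E by rewrite inver gt_eqF.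
rewrite -inve_pge ?inE ?radial_ge0 ?lee_fin ?enorm_ge0//.
by split=> [[xE|//]|]; [rewrite xE eqxx in x0|right].
Qed.

End StarSets.

(** * Flowers and polars *)

Section Flowers.
Context {R : realType} {n : nat}.
Implicit Types x y theta : 'rV[R]_n.
Implicit Types C K A : set 'rV[R]_n.

Definition ball_union C := \bigcup_(x in C) eball (2^-1 *: x) (enorm x / 2).

Lemma ball_union_star C : C !=set0 -> star_set (ball_union C).
Proof.
case=> c Cc; split.
  by exists 0, c => //; apply/eball_diameterP; rewrite dotC !dot0l.
move=> x l [d Cd /eball_diameterP xd] /andP[l0 l1]; exists d => //.
apply/eball_diameterP; rewrite dotZl !dotZr; apply: ler_wpM2l => //.
by apply: le_trans xd; rewrite ler_piMl// dot_ge0.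
Qed.

(** On the ray spanned by [theta], the ball with diameter [0, c] reaches up to
    the projection [dot c theta] of [c]. *)
Lemma radial_ball_union C theta : C !=set0 -> sphere theta ->
  radial (ball_union C) theta = maxe 0%E (Defs.support C theta).
Proof.
move=> C0 th; have U0 := star_set0 (ball_union_star C0).
have ray c l : 0 < l ->
    eball (2^-1 *: c) (enorm c / 2) (l *: theta) <-> l <= dot c theta.
  move=> l0; rewrite eball_diameterP dotZl !dotZr (dot_sphere th) mulr1.
  by rewrite ler_pM2l.
apply/eqP; rewrite eq_le ge_max radial_ge0//=; apply/andP; split.
  apply: ge_ereal_sup => _ [l [l0 [c Cc lc]] <-]; rewrite le_max lee_fin.
  have [//|lgt0] := leP l 0.
  apply: le_ereal_sup_tmp; exists (dot c theta)%:E; first by exists c.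
  by rewrite lee_fin; apply/ray.
apply: ge_ereal_sup => _ [c Cc <-]; have [c0|c0] := leP (dot c theta) 0.
  by apply: le_trans (radial_ge0 _ U0); rewrite lee_fin.
apply: ereal_sup_ubound; exists (dot c theta) => //; split; first exact: ltW.
by exists c => //; apply/ray.
Qed.

(** [Phi] inverts the support function, and [h <= 1 / |y|] in the direction of
    [y] is the family of inequalities defining the polar. *)
Lemma Phi_ball_union C : C !=set0 -> Phi (ball_union C) = polar C.
Proof.
move=> C0; have U0 := star_set0 (ball_union_star C0).
rewrite predeqE => y; have [->|y0] := eqVneq y 0.
  split=> _; last by left.
  by move=> x _; rewrite dotC dot0l ler01.
have ny0 := enorm_gt0 y0.
rewrite PhiP// radial_ball_union//; last exact: sphere_normalize.
rewrite ge_max lee_fin invr_ge0 enorm_ge0/=.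
have le1 x : (dot x ((enorm y)^-1 *: y) <= (enorm y)^-1) = (dot x y <= 1).
  by rewrite dotZr ler_pdivrMl// divff// gt_eqF.
split=> [h x Cx|h]; last first.
  by apply: ge_ereal_sup => _ [x Cx <-]; rewrite lee_fin le1 h.
by rewrite -le1 -lee_fin; apply: le_trans h; apply: ereal_sup_ubound; exists x.
Qed.

Lemma clubsuitE K : K 0 -> clubsuit K = ray_closure (ball_union K).
Proof.
move=> K0; have nK : K !=set0 by exists 0.
rewrite ray_closureE; last exact: ball_union_star.
apply: eq_star_body_of => theta th; rewrite radial_ball_union//.
apply/esym/max_idPr; apply: ereal_sup_ubound; exists 0 => //.
by rewrite dot0l.
Qed.

Lemma clubsuit_flower K : closed K -> K 0 -> flower (clubsuit K).
Proof.
move=> cK K0; split; last by exists K => //; exact: clubsuitE.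
apply: star_body_of_star_body => theta _; apply: ereal_sup_ubound.
by exists 0; rewrite ?dot0l.
Qed.

Lemma Phi_clubsuit K : K 0 -> Phi (clubsuit K) = polar K.
Proof.
move=> K0; have nK : K !=set0 by exists 0.
by rewrite clubsuitE// Phi_ray_closure ?Phi_ball_union//; exact: ball_union_star.
Qed.

(** The set of centers is nonempty because a star body contains [0], so that the
    image is a polar. *)
Lemma Phi_flower_convex_body A : flower A -> convex_body (Phi A).
Proof.
move=> [bA [C cC AE]]; have C0 : C !=set0.
  have := star_body0 bA; rewrite AE => -[[c Cc _]|[theta [_ fr] _]].
    by exists c.
  (* The supremum over an empty union would be -oo, which is not finite. *)
  apply/set0P; apply/eqP => CE; move: fr; rewrite CE bigcup_set0 /= fin_numE.
  by case/andP => /eqP + _; apply; apply/ereal_sup_ninfty => _ [l [_ []]].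
rewrite AE Phi_ray_closure; last exact: ball_union_star.
by rewrite Phi_ball_union//; exact: polar_convex_body.
Qed.

(** This is [Phi_clubsuit] for the polar of [K], read through the bipolar
    theorem. *)
Lemma convex_bodyE K : convex_body K -> K = Phi (clubsuit (polar K)).
Proof.
move=> bK; rewrite Phi_clubsuit ?polarK//.
by case: (polar_convex_body K).
Qed.

Lemma clubsuit_polar_flower K : flower (clubsuit (polar K)).
Proof. by case: (polar_convex_body K) => ? _ ?; exact: clubsuit_flower. Qed.

Lemma Phi_convex_body K : convex_body K -> Phi K = clubsuit (polar K).
Proof.
move=> /convex_bodyE {1}->; apply: PhiK.
by case: (clubsuit_polar_flower K).
Qed.

End Flowers.

Theorem theorem12 (R : realType) (n : nat) :
  set_bij (@convex_body R n) (@flower R n) (@Phi R n) /\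
  [/\ set_fun (@convex_body R n) (@convex_body R n) (@polar R n),
      set_fun (@convex_body R n) (@flower R n) (@clubsuit R n),
      set_fun (@flower R n) (@convex_body R n) (@Phi R n) &
      forall K : set 'rV[R]_n, convex_body K -> Phi (clubsuit K) = polar K].
Proof.
split; last split.
- split=> [K bK|K L|A fA].
  + by rewrite /= Phi_convex_body//; exact: clubsuit_polar_flower.
  + rewrite !inE => bK bL KL.
    by rewrite (convex_bodyE bK) (convex_bodyE bL) -!Phi_convex_body// KL.
  + by exists (Phi A); [exact: Phi_flower_convex_body|case: fA => /PhiK].
- by move=> K _; exact: polar_convex_body.
- by move=> K [cK _ K0]; exact: clubsuit_flower.
- exact: Phi_flower_convex_body.
- by move=> K [_ _ K0]; exact: Phi_clubsuit.
Qed.
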